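(* Let $N$ be a countable subgroup of a countable group $G$ and let $\alpha:G/N\times G\to N$ be any cocycle such that the restriction $\alpha(N,\cdot)|_N:N\to N$, $n\mapsto\alpha(N,n)$, is bijective. Let $\pi:N\to\mathcal U(H)$ be a unitary representation. If $\pi$ has a Parseval frame vector (respectively a frame vector, respectively a weak frame vector), then the induced representation $\operatorname{Ind}_N^G\pi:G\to\mathcal U(\ell^2(G/N,H))$ with respect to $\alpha$ also has a Parseval frame vector (respectively a frame vector, respectively a weak frame vector).
   Context: ''Countable'' means countably infinite; groups are discrete. Hilbert spaces are complex and separable; $\mathcal U(H)$ is the group of unitary operators on $H$. $G/N$ denotes the set of right cosets $Nh$, $h\in G$ (with counting measure), on which $G$ acts on the right by $(Nh)g=N(hg)$; in $\alpha(N,\cdot)$ the first argument $N$ denotes the coset of the identity. The index of $N$ in $G$ may be infinite. A cocycle is a map $\alpha:G/N\times G\to N$ with $\alpha(x,g_1g_2)=\alpha(x,g_1)\,\alpha(xg_1,g_2)$ for all $x\in G/N$ and $g_1,g_2\in G$. $\ell^2(G/N,H)$ is the Hilbert space of functions $\psi:G/N\to H$ with $\sum_{x\in G/N}\|\psi(x)\|^2<\infty$ and inner product $\langle\phi,\psi\rangle=\sum_{x\in G/N}\langle\phi(x),\psi(x)\rangle_H$. The induced representation $\rho=\operatorname{Ind}_N^G\pi$ with respect to $\alpha$ is $(\rho_g\varphi)(x)=\pi[\alpha(x,g)]\big(\varphi(xg)\big)$ for $g\in G$, $x\in G/N$, $\varphi\in\ell^2(G/N,H)$. Frames: a family $\{f_n\}_{n\in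 S}$ ($S$ countable) in a Hilbert space $K$ is a frame if there are $A,B>0$ with $A\|v\|^2\le\sum_{n\in S}|\langle v,f_n\rangle|^2\le B\|v\|^2$ for all $v\in K$; a Parseval frame if $A=B=1$ works; a weak frame if the upper inequality holds for some $B>0$ and all $v\in K$ and the linear span of the family is dense in $K$. For a unitary representation $\sigma$ of a countable group $\Gamma$ on $K$, a vector $\varphi\in K$ is a Parseval frame (respectively frame, weak frame) vector if $\{\sigma_g\varphi\}_{g\in\Gamma}$ is a Parseval frame (respectively frame, weak frame) for $K$. *)

(* Defs.v *)
From HB Require Import structures.
From mathcomp Require Import all_boot all_order all_algebra.
From mathcomp Require Import finmap complex.
From mathcomp Require Import mathcomp_extra boolp classical_sets functions.
From mathcomp Require Import cardinality fsbigop reals ereal interval_inference.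
From mathcomp Require Import topology normedtype numfun esum.
From mathcomp Require Import lra ring.

Set Implicit Arguments.
Unset Strict Implicit.
Unset Printing Implicit Defensive.
Import Order.TTheory GRing.Theory Num.Theory.
Import numFieldNormedType.Exports.
Local Open Scope classical_set_scope.
Local Open Scope ring_scope.

Section RealSum.
Variables (R : realType) (X : choiceType).
Implicit Types (f g h : X -> R) (c : R).

(* Unconditional sum over an arbitrary index type: positive part minus negative
   part.  It is meaningful for absolutely summable f only. *)
Definition rsum f : R :=
  fine (\esum_(x in [set: X]) (Num.max (f x) 0)%:E) -
  fine (\esum_(x in [set: X]) (Num.max (- f x) 0)%:E).

Definition abs_summable f := (\esum_(x in [set: X]) `|f x|%:E < +oo)%E.

Lemma abs_summable_le f g :
  (forall x, `|f x| <= `|g x|) -> abs_summable g -> abs_summable f.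
Proof. by move=> fg; apply: le_lt_trans; apply: le_esum => x _; rewrite lee_fin. Qed.

Lemma abs_summableD f g :
  abs_summable f -> abs_summable g -> abs_summable (f \+ g).
Proof.
move=> sf sg; apply: le_lt_trans (lte_add_pinfty sf sg).
rewrite -esumD => [|x _|x _]; rewrite ?lee_fin//.
by apply: le_esum => x _; rewrite -EFinD lee_fin ler_normD.
Qed.

Lemma esum_fin f : (forall x, 0 <= f x) -> abs_summable f ->
  \esum_(x in [set: X]) (f x)%:E =
  (fine (\esum_(x in [set: X]) (f x)%:E))%:E.
Proof.
move=> f0 sf; rewrite fineK// ge0_fin_numE; last first.
  by apply: esum_ge0 => x _; rewrite lee_fin.
by rewrite (eq_esum (b := fun x => `|f x|%:E))// => x _; rewrite ger0_norm.
Qed.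

Lemma esumZ_le f c : 0 <= c -> (forall x, 0 <= f x) ->
  (\esum_(x in [set: X]) (c * f x)%:E <= c%:E * \esum_(x in [set: X]) (f x)%:E)%E.
Proof.
move=> c0 f0; apply: ge_ereal_sup => _ [A [finA _] <-].
rewrite (eq_fsbigr (fun x => c%:E * (f x)%:E)%E); last by move=> x _; rewrite EFinM.
rewrite -ge0_mule_fsumr; last by move=> x; rewrite lee_fin.
by rewrite lee_pmul// ?lee_fin//; [apply: fsume_ge0 => x _; rewrite lee_fin|
  apply: esum_ge; exists A].
Qed.

Lemma abs_summableZ f c : abs_summable f -> abs_summable (fun x => c * f x).
Proof.
move=> sf; rewrite /abs_summable.
rewrite (eq_esum (b := fun x => (`|c| * `|f x|)%:E)); last first.
  by move=> x _; rewrite normrM.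
apply: le_lt_trans (esumZ_le _ _) _ => //.
by apply: lte_mul_pinfty; rewrite ?lee_fin.
Qed.

Lemma esumZ f c : 0 <= c -> (forall x, 0 <= f x) -> abs_summable f ->
  \esum_(x in [set: X]) (c * f x)%:E =
  (c * fine (\esum_(x in [set: X]) (f x)%:E))%:E.
Proof.
move=> c0 f0 sf; rewrite EFinM -esum_fin//.
move: c0; rewrite le_eqVlt => /predU1P[<-|c0].
  by rewrite mul0e esum1// => x _; rewrite mul0r.
apply/eqP; rewrite eq_le (esumZ_le (ltW c0))//=.
have := @esumZ_le (fun x => c * f x) c^-1.
rewrite invr_ge0 => /(_ (ltW c0) (fun x => mulr_ge0 (ltW c0) (f0 x))).
rewrite (eq_esum (b := fun x => (f x)%:E)); last first.
  by move=> x _; rewrite mulKf ?gt_eqF.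
move=> /(lee_wpmul2l (_ : (0 <= c%:E)%E)); rewrite lee_fin => /(_ (ltW c0)).
by rewrite muleA -EFinM divff ?gt_eqF// mul1e.
Qed.

Lemma abs_summable_max f : abs_summable f -> abs_summable (fun x => Num.max (f x) 0).
Proof.
apply: abs_summable_le => x; case: (lerP (f x) 0) => _ //.
by rewrite normr0.
Qed.

Lemma abs_summableN f : abs_summable f -> abs_summable (fun x => - f x).
Proof. by apply: abs_summable_le => x; rewrite normrN. Qed.

Lemma esum_fineD f g : (forall x, 0 <= f x) -> (forall x, 0 <= g x) ->
  abs_summable f -> abs_summable g ->
  fine (\esum_(x in [set: X]) (f x + g x)%:E) =
  fine (\esum_(x in [set: X]) (f x)%:E) + fine (\esum_(x in [set: X]) (g x)%:E).
Proof.
move=> f0 g0 sf sg; rewrite (eq_esum (b := fun x => (f x)%:E + (g x)%:E)%E)//.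
rewrite esumD => [|x _|x _]; rewrite ?lee_fin//.
by rewrite (esum_fin f0 sf) (esum_fin g0 sg).
Qed.

Lemma rsumB g h : (forall x, 0 <= g x) -> (forall x, 0 <= h x) ->
  abs_summable g -> abs_summable h ->
  rsum (fun x => g x - h x) =
  fine (\esum_(x in [set: X]) (g x)%:E) - fine (\esum_(x in [set: X]) (h x)%:E).
Proof.
move=> g0 h0 sg sh; rewrite /rsum.
have sgh : abs_summable (fun x => g x - h x).
  exact: (abs_summableD sg (abs_summableN sh)).
have M0 f x : 0 <= Num.max (f x) 0 :> R by rewrite le_max lexx orbT.
apply/eqP; rewrite subr_eq addrAC eq_sym subr_eq; apply/eqP.
rewrite -!esum_fineD//.
- congr fine; apply: eq_esum => x _; congr _%:E.
  by case: (lerP (g x - h x) 0); case: (lerP (- (g x - h x)) 0); lra.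
- exact: (M0 (fun x => g x - h x)).
- exact: (abs_summable_max sgh).
- exact: (M0 (fun x => - (g x - h x))).
- exact: (abs_summable_max (abs_summableN sgh)).
Qed.

Lemma rsum_ge0 f : (forall x, 0 <= f x) -> abs_summable f ->
  rsum f = fine (\esum_(x in [set: X]) (f x)%:E).
Proof.
move=> f0 sf; have s0 : abs_summable (fun=> 0).
  by apply: abs_summable_le sf => x; rewrite normr0.
have := rsumB f0 (fun=> lexx 0) sf s0.
rewrite [X in _ - fine X]esum1// subr0 => <-.
by congr rsum; apply/funext => x; rewrite subr0.
Qed.

Lemma posnegE f : f = (fun x => Num.max (f x) 0 - Num.max (- f x) 0).
Proof. by apply/funext => x; case: (lerP (f x) 0); case: (lerP (- f x) 0); lra. Qed.

Lemma rsumD f g : abs_summable f -> abs_summable g ->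
  rsum (fun x => f x + g x) = rsum f + rsum g.
Proof.
move=> sf sg.
have -> : (fun x => f x + g x) = (fun x =>
   (Num.max (f x) 0 + Num.max (g x) 0) - (Num.max (- f x) 0 + Num.max (- g x) 0)).
  by apply/funext => x; rewrite {1}(posnegE f) {1}(posnegE g) /=; ring.
have M0 h x : 0 <= Num.max (h x) 0 :> R by rewrite le_max lexx orbT.
have N0 h x : 0 <= Num.max (- h x) 0 :> R by rewrite le_max lexx orbT.
have sfp := abs_summable_max sf; have sgp := abs_summable_max sg.
have sfn := abs_summable_max (abs_summableN sf).
have sgn := abs_summable_max (abs_summableN sg).
rewrite rsumB ?esum_fineD//.
- by rewrite /rsum; ring.
- by move=> x; rewrite addr_ge0.
- by move=> x; rewrite addr_ge0.
- exact: (abs_summableD sfp sgp).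
- exact: (abs_summableD sfn sgn).
Qed.

Lemma rsumN f : rsum (fun x => - f x) = - rsum f.
Proof. by rewrite /rsum opprB; congr (_ - fine _); apply: eq_esum => x _; rewrite opprK. Qed.

Lemma rsumZ c f : abs_summable f -> rsum (fun x => c * f x) = c * rsum f.
Proof.
move=> sf; wlog c0 : c / 0 <= c => [hw|].
  have [/hw//|/ltW c0] := lerP 0 c.
  apply: oppr_inj; rewrite -mulNr -hw ?oppr_ge0// -rsumN.
  by congr rsum; apply/funext => x; rewrite mulNr.
have M0 h x : 0 <= Num.max (h x) 0 :> R by rewrite le_max lexx orbT.
have N0 h x : 0 <= Num.max (- h x) 0 :> R by rewrite le_max lexx orbT.
have sfp := abs_summable_max sf.
have sfn := abs_summable_max (abs_summableN sf).
have -> : (fun x => c * f x) =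
    (fun x => c * Num.max (f x) 0 - c * Num.max (- f x) 0).
  by apply/funext => x; rewrite {1}(posnegE f) mulrBr.
rewrite rsumB ?esumZ//=.
- by rewrite /rsum mulrBr.
- by move=> x; rewrite mulr_ge0.
- by move=> x; rewrite mulr_ge0.
- exact: abs_summableZ.
- exact: abs_summableZ.
Qed.

Lemma rsum_reindex (e : X -> X) f : set_bij setT setT e -> rsum (f \o e) = rsum f.
Proof.
move=> be; rewrite /rsum.
rewrite (reindex_esum setT setT e (fun x => (Num.max (f x) 0)%:E))//.
by rewrite (reindex_esum setT setT e (fun x => (Num.max (- f x) 0)%:E))//.
Qed.

End RealSum.

Section DotNorm.
Variables (C : numClosedFieldType) (U : lmodType C) (dot : {dot U for Num.conj}).
Implicit Types u v : U.

Lemma dot_CauchySchwarz u v : `|dot u v| ^+ 2 <= dot u u * dot v v.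
Proof.
have [->|v0] := eqVneq v 0; first by rewrite !linear0r normr0 expr0n mulr0.
pose a := dot u v / dot v v; pose w := u - a *: v.
have wv : dot w v = 0.
  by rewrite linearBl linearZl_LR /= divfK ?subrr ?dnorm_eq0.
have -> : u = w + a *: v by rewrite subrK.
rewrite linearDl /= wv add0r linearZl_LR /= normrM (ger0_norm (dnorm_ge0 _ _)).
rewrite exprMn hnormDd /=; last by rewrite linearZr_LR /= wv mulr0.
rewrite mulrDl dnormZ expr2 mulrA lerDr.
by rewrite mulr_ge0 ?dnorm_ge0.
Qed.

Definition dot_norm u : C := sqrtC (dot u u).

Lemma dot_normE u : dot_norm u ^+ 2 = dot u u.
Proof. exact: sqrtCK. Qed.

Lemma dot_norm_ge0 u : 0 <= dot_norm u.
Proof. exact: sqrt_dnorm_ge0. Qed.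

Lemma dot_norm_eq0 u : dot_norm u = 0 -> u = 0.
Proof. by move/eqP; rewrite sqrt_dnorm_eq0 => /eqP. Qed.

Lemma dot_normZ a u : dot_norm (a *: u) = `|a| * dot_norm u.
Proof. by rewrite /dot_norm dnormZ sqrtCM ?nnegrE ?exprn_ge0 ?dnorm_ge0// sqrCK. Qed.

Lemma norm_dot_le u v : `|dot u v| <= dot_norm u * dot_norm v.
Proof.
rewrite -ler_sqr ?nnegrE ?mulr_ge0 ?dot_norm_ge0//.
by rewrite exprMn !dot_normE dot_CauchySchwarz.
Qed.

Lemma dot_normD u v : dot_norm (u + v) <= dot_norm u + dot_norm v.
Proof.
rewrite -ler_sqr ?nnegrE ?addr_ge0 ?dot_norm_ge0//.
rewrite sqrrD !dot_normE dnormD addrAC lerD2r// lerD2l.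
have dr : dot u v + (dot u v)^* \is Num.real.
  by rewrite CrealE rmorphD /= conjCK addrC.
apply: le_trans (real_ler_norm dr) _.
apply: le_trans (ler_normD _ _) _.
by rewrite norm_conjC -mulr2n lerMn2r norm_dot_le orbT.
Qed.

End DotNorm.

Section RealModulus.
Variables (R : realType).
Implicit Types (V : normedZmodType R[i]).

(* Over the scalars R[i] the library norm is R[i]-valued; rnorm is the same norm
   with values in R.  It applies to vectors and to scalars alike. *)
Definition rnorm V (v : V) : R := complex.Re `|v|.

Lemma rnormE V (v : V) : (real_complex R (rnorm v)) = `|v|.
Proof. by rewrite /rnorm RRe_real// ger0_real. Qed.

Lemma rnorm_ge0 V (v : V) : 0 <= rnorm v.
Proof. by rewrite -ler0c rnormE. Qed.

Lemma rnormD V (u v : V) : rnorm (u + v) <= rnorm u + rnorm v.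
Proof. by rewrite -lecR rmorphD /= !rnormE ler_normD. Qed.

Lemma Re_le_rnorm (z : R[i]) : `|complex.Re z| <= rnorm z.
Proof.
case: z => a b; rewrite /rnorm normc_def /= -sqrtr_sqr ler_wsqrtr//.
by rewrite lerDl sqr_ge0.
Qed.

Lemma Im_le_rnorm (z : R[i]) : `|complex.Im z| <= rnorm z.
Proof.
case: z => a b; rewrite /rnorm normc_def /= -sqrtr_sqr ler_wsqrtr//.
by rewrite lerDr sqr_ge0.
Qed.

End RealModulus.

Section ComplexSum.
Variables (R : realType) (X : choiceType).
Implicit Types (f g : X -> R[i]).

Definition csum f : R[i] :=
  Complex (rsum (fun x => complex.Re (f x))) (rsum (fun x => complex.Im (f x))).

Definition cabs_summable f := abs_summable (fun x => rnorm (f x)).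

Lemma cabs_summable_Re f : cabs_summable f -> abs_summable (fun x => complex.Re (f x)).
Proof.
apply: abs_summable_le => x; rewrite (ger0_norm (rnorm_ge0 _)); exact: Re_le_rnorm.
Qed.

Lemma cabs_summable_Im f : cabs_summable f -> abs_summable (fun x => complex.Im (f x)).
Proof.
apply: abs_summable_le => x; rewrite (ger0_norm (rnorm_ge0 _)); exact: Im_le_rnorm.
Qed.

Lemma csumP (a : R[i]) f g : cabs_summable f -> cabs_summable g ->
  csum (fun x => a * f x + g x) = a * csum f + csum g.
Proof.
move=> sf sg; have sfr := cabs_summable_Re sf; have sfi := cabs_summable_Im sf.
have sgr := cabs_summable_Re sg; have sgi := cabs_summable_Im sg.
have zr c := abs_summableZ c sfr; have zi c := abs_summableZ c sfi.
case: a => p q; rewrite /csum.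
have -> : (fun x => complex.Re (Complex p q * f x + g x)) =
    (fun x => (p * complex.Re (f x) + - q * complex.Im (f x)) + complex.Re (g x)).
  by apply/funext => x; case: (f x) (g x) => a b [c d] /=; rewrite mulNr.
have -> : (fun x => complex.Im (Complex p q * f x + g x)) =
    (fun x => (p * complex.Im (f x) + q * complex.Re (f x)) + complex.Im (g x)).
  by apply/funext => x; case: (f x) (g x) => a b [c d] /=.
rewrite !rsumD ?rsumZ//; try exact: abs_summableD.
by congr Complex; rewrite /= ?mulNr.
Qed.

Lemma csum_conj f : csum (fun x => (f x)^*) = (csum f)^*.
Proof.
rewrite /csum -[RHS]/(Complex _ _); congr Complex.
  by congr rsum; apply/funext => x; case: (f x).
by rewrite -rsumN; congr rsum; apply/funext => x; case: (f x).
Qed.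

Lemma csum_real (f : X -> R) : (forall x, 0 <= f x) -> abs_summable f ->
  csum (fun x => real_complex R (f x)) =
  real_complex R (fine (\esum_(x in [set: X]) (f x)%:E)).
Proof.
move=> f0 sf; rewrite /csum /= rsum_ge0//; congr Complex.
by rewrite rsum_ge0 ?esum1//; apply: abs_summable_le sf => x; rewrite normr0.
Qed.

Lemma csum_reindex (e : X -> X) f : set_bij setT setT e -> csum (f \o e) = csum f.
Proof.
move=> be; rewrite /csum; congr Complex.
  exact: (rsum_reindex (fun x => complex.Re (f x)) be).
exact: (rsum_reindex (fun x => complex.Im (f x)) be).
Qed.

End ComplexSum.

(* {dot H for Num.conj} is a positive definite Hermitian form, linear in the
   first argument and conjugate-linear in the second one. *)
HB.mixin Record CompleteNormedModule_isHilbert (R : realType) H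
    & CompleteNormedModule R[i] H := {
  hdot : {dot H for Num.conj};
  hdot_norm : forall u : H, hdot u u = `|u| ^+ 2
}.

#[short(type="hilbertType")]
HB.structure Definition Hilbert (R : realType) :=
  {H of CompleteNormedModule R[i] H & CompleteNormedModule_isHilbert R H}.

Section L2.
Variables (R : realType) (X : choiceType) (H : hilbertType R).

Definition square_summable : {pred X -> H} :=
  fun psi => `[< (\esum_(x in [set: X]) (rnorm (psi x) ^+ 2)%:E < +oo)%E >].

Lemma square_summableP (psi : X -> H) :
  reflect (abs_summable (fun x => rnorm (psi x) ^+ 2)) (psi \in square_summable).
Proof.
rewrite unfold_in; apply: (iffP (asboolP _)); apply: le_lt_trans; apply: le_esum => x _;
  by rewrite lee_fin ger0_norm// exprn_ge0// rnorm_ge0.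
Qed.

Lemma square_summable_submod : submod_closed square_summable.
Proof.
split=> [|a u v /square_summableP su /square_summableP sv]; apply/square_summableP.
  rewrite /abs_summable esum1 => [|x _]; first exact: ltry.
  by rewrite /rnorm normr0 expr0n normr0.
have := abs_summableD (abs_summableZ (2 * rnorm a ^+ 2) su) (abs_summableZ 2 sv).
apply: abs_summable_le => x /=.
have na : rnorm (a *: u x) = rnorm a * rnorm (u x).
  by apply: complexI; rewrite rmorphM /= !rnormE normrZ.
have := rnormD (a *: u x) (v x); rewrite na.
have := rnorm_ge0 (u x); have := rnorm_ge0 (v x); have := rnorm_ge0 a.
have := rnorm_ge0 (a *: u x + v x).
rewrite -[(a *: u + v) x]/(a *: u x + v x).
move: (rnorm _) (rnorm a) (rnorm (u x)) (rnorm (v x)) => n p q r n0 p0 r0 q0 h.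
rewrite !ger0_norm ?addr_ge0 ?mulr_ge0 ?exprn_ge0//.
have : n ^+ 2 <= (p * q + r) ^+ 2 by rewrite ler_sqr ?nnegrE ?addr_ge0 ?mulr_ge0.
move/le_trans; apply; have := sqr_ge0 (p * q - r); nra.
Qed.

HB.instance Definition _ :=
  GRing.isSubmodClosed.Build R[i] (X -> H) square_summable square_summable_submod.

Record l2 := L2 { l2_fun :> X -> H; l2P : l2_fun \in square_summable }.

HB.instance Definition _ := [isSub for l2_fun].
HB.instance Definition _ := [Choice of l2 by <:].
HB.instance Definition _ := [SubChoice_isSubLmodule of l2 by <:].

Implicit Types (phi psi : l2).

Lemma l2_summable psi : abs_summable (fun x => rnorm (psi x) ^+ 2).
Proof. exact/square_summableP/l2P. Qed.

Lemma dot_summable phi psi : cabs_summable (fun x => hdot (phi x) (psi x)).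
Proof.
have := abs_summableD (l2_summable phi) (l2_summable psi).
apply: abs_summable_le => x.
rewrite !ger0_norm ?addr_ge0 ?exprn_ge0 ?rnorm_ge0//.
have h : rnorm (hdot (phi x) (psi x)) ^+ 2 <= rnorm (phi x) ^+ 2 * rnorm (psi x) ^+ 2.
  rewrite -lecR [X in _ <= X]rmorphM !rmorphXn /= !rnormE -!hdot_norm; exact: dot_CauchySchwarz.
have aux (n p q : R) : 0 <= n -> 0 <= p -> 0 <= q ->
    n ^+ 2 <= p ^+ 2 * q ^+ 2 -> n <= p ^+ 2 + q ^+ 2.
  move=> n0 p0 q0; rewrite -exprMn ler_sqr ?nnegrE ?mulr_ge0// => /le_trans; apply.
  by have := sqr_ge0 (p - q); have := mulr_ge0 p0 q0; nra.
by apply: aux => //; exact: rnorm_ge0.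
Qed.

Definition l2_dot phi psi : R[i] := csum (fun x => hdot (phi x) (psi x)).

Lemma l2_dotC phi psi : l2_dot phi psi = (l2_dot psi phi)^*.
Proof.
rewrite /l2_dot -csum_conj; congr csum; apply/funext => x.
by rewrite hermC /= expr0 mul1r.
Qed.

Lemma l2_dotPl psi : GRing.linear_for *%R (l2_dot ^~ psi).
Proof.
move=> a u v; rewrite /l2_dot -csumP; try exact: dot_summable.
congr csum; apply/funext => x.
by rewrite -linearZl_LR -linearDl.
Qed.

Lemma l2_dotPr phi : GRing.linear_for (Num.conj \; *%R) (l2_dot phi).
Proof.
move=> a u v; rewrite l2_dotC l2_dotPl rmorphD rmorphM /=.
by rewrite -!l2_dotC.
Qed.

Lemma l2_dot_bilinear : bilinear_for
  (GRing.Scale.Law.clone _ _ *%R _) (GRing.Scale.Law.clone _ _ (Num.conj \; *%R) _)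
  l2_dot.
Proof. by split; [exact: l2_dotPl|exact: l2_dotPr]. Qed.

HB.instance Definition _ := bilinear_isBilinear.Build R[i] l2 l2 R[i]
  (GRing.Scale.Law.clone _ _ *%R _)
  (GRing.Scale.Law.clone _ _ (Num.conj \; *%R) _) l2_dot l2_dot_bilinear.

Lemma l2_dot_herm phi psi : l2_dot phi psi = (-1) ^+ false * (l2_dot psi phi)^*.
Proof. by rewrite expr0 mul1r l2_dotC. Qed.

HB.instance Definition _ :=
  isHermitianSesquilinear.Build R[i] l2 false Num.conj l2_dot l2_dot_herm.

Lemma l2_dotE psi : l2_dot psi psi =
  real_complex R (fine (\esum_(x in [set: X]) (rnorm (psi x) ^+ 2)%:E)).
Proof.
rewrite -csum_real; last exact: l2_summable; last by move=> x; rewrite exprn_ge0 ?rnorm_ge0.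
by congr csum; apply/funext => x; rewrite hdot_norm rmorphXn /= rnormE.
Qed.

Lemma l2_esumE psi : \esum_(x in [set: X]) (rnorm (psi x) ^+ 2)%:E =
  (complex.Re (l2_dot psi psi))%:E.
Proof.
rewrite l2_dotE [RHS]/= -esum_fin//; last exact: l2_summable.
by move=> x; rewrite exprn_ge0 ?rnorm_ge0.
Qed.

Lemma l2_coord_le psi x : ((rnorm (psi x) ^+ 2)%:E <=
  \esum_(x in [set: X]) (rnorm (psi x) ^+ 2)%:E)%E.
Proof.
apply: esum_ge; exists [set x]; first by split.
by rewrite fsbig_set1.
Qed.

Lemma l2_dot_gt0 psi : psi != 0 -> 0 < l2_dot psi psi.
Proof.
move=> psi0; have [x xN0] : exists x, psi x != 0.
  apply: contrapT => /forallNP h; move/eqP: psi0; apply; apply/val_inj/funext => x.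
  exact/eqP/negPn/negP/h.
rewrite l2_dotE ltcR -lte_fin -esum_fin; last exact: l2_summable.
  apply: lt_le_trans (l2_coord_le psi x); rewrite lte_fin exprn_gt0//.
  by rewrite -ltcR rnormE normr_gt0.
by move=> y; rewrite exprn_ge0 ?rnorm_ge0.
Qed.

HB.instance Definition _ := isDotProduct.Build R[i] l2 l2_dot l2_dot_gt0.

Let dt : {dot l2 for Num.conj} := l2_dot.

HB.instance Definition _ := Lmodule_isNormed.Build R[i] l2
  (dot_normD dt) (dot_normZ dt) (@dot_norm_eq0 _ _ dt).

Lemma l2_dot_norm psi : l2_dot psi psi = `|psi| ^+ 2.
Proof. exact/esym/(dot_normE dt). Qed.

Lemma l2_norm_le psi (e : R[i]) : 0 <= e ->
  (`|psi| <= e) = (\esum_(x in [set: X]) (rnorm (psi x) ^+ 2)%:E <=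
                   (complex.Re e ^+ 2)%:E)%E.
Proof.
move=> e0; rewrite -ler_sqr ?nnegrE// -l2_dot_norm l2_esumE lee_fin.
have eE : e = real_complex R (complex.Re e) by rewrite RRe_real// ger0_real.
by rewrite {1}eE -rmorphXn l2_dotE /= lecR.
Qed.

Lemma l2_coord_norm psi x : `|psi x| <= `|psi|.
Proof.
rewrite -ler_sqr ?nnegrE// -l2_dot_norm -rnormE -rmorphXn l2_dotE lecR.
rewrite -lee_fin -esum_fin; first exact: l2_coord_le.
  by move=> y; rewrite exprn_ge0 ?rnorm_ge0.
exact: l2_summable.
Qed.

Lemma l2_complete (F : set_system l2) : ProperFilter F -> cauchy F -> cvg F.
Proof.
move=> FF Fc.
have Fball e : 0 < e -> exists psi, \forall phi \near F, `|psi - phi| < e.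
  move=> e0; have /cauchyP/(_ e e0)[psi Fpsi] := Fc; exists psi.
  by apply: filterS Fpsi => phi; rewrite -ball_normE.
pose ev x (phi : l2) : H := phi x.
have Fx x : cvg (ev x @ F).
  apply: cauchy_cvg; apply: cauchy_exP => e e0.
  have [psi Fpsi] := Fball e e0; exists (psi x).
  apply: filterS Fpsi => phi h; rewrite -ball_normE /=.
  exact: le_lt_trans (l2_coord_norm (psi - phi) x) h.
pose f x : H := lim (ev x @ F).
have Ff x : ev x @ F --> f x by exact: Fx.
have cvgn psi x : (fun phi => rnorm (psi x - ev x phi) ^+ 2) @ F -->
    (rnorm (psi x - f x) ^+ 2 : R).
  suff h : (fun phi => rnorm (psi x - ev x phi)) @ F --> (rnorm (psi x - f x) : R).
    by under eq_fun do rewrite expr2; rewrite expr2; exact: cvgM.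
  apply/cvgrPdist_lt => e e0.
  have /cvgrPdist_lt /(_ (real_complex R e)) := Ff x.
  rewrite ltcR => /(_ e0); apply: filterS => phi h.
  rewrite -ltcR; apply: le_lt_trans h.
  rewrite -rnormE lecR ler_norml.
  have h1 := rnormD (psi x - ev x phi) (ev x phi - f x).
  have h2 := rnormD (psi x - f x) (f x - ev x phi).
  move: h1 h2; rewrite !addrA !subrK.
  have -> : rnorm (ev x phi - f x) = rnorm (f x - ev x phi) by rewrite /rnorm distrC.
  by move=> h1 h2; apply/andP; split; lra.
have Fle psi (e : R[i]) : 0 < e -> (\forall phi \near F, `|psi - phi| < e) ->
    (\esum_(x in [set: X]) (rnorm (psi x - f x) ^+ 2)%:E <= (complex.Re e ^+ 2)%:E)%E.
  move=> e0 He; apply: ge_ereal_sup => _ [A [finA _] <-].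
  rewrite fsbig_finite// sumEFin lee_fin.
  have cs (r : seq X) : (fun phi => \sum_(x <- r) rnorm (psi x - ev x phi) ^+ 2) @ F -->
      (\sum_(x <- r) rnorm (psi x - f x) ^+ 2 : R).
    elim: r => [|y s IHs].
      by rewrite big_nil; under eq_fun do rewrite big_nil; exact: cvg_cst.
    by rewrite big_cons; under eq_fun do rewrite big_cons; exact: cvgD.
  apply: (cvgr_to_le (cs _)); apply: filterS He => phi /ltW h.
  rewrite -lee_fin -sumEFin; move: h; rewrite (l2_norm_le _ (ltW _))//; apply: le_trans.
  apply: esum_ge; exists A => //.
  by rewrite fsbig_finite.
have [psi1 F1] := Fball 1 ltr01.
have sf1 : (fun x => psi1 x - f x) \in square_summable.
  rewrite unfold_in; apply/asboolP.
  exact: le_lt_trans (Fle psi1 1 ltr01 F1) (ltry _).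
pose lim_ : l2 := psi1 - L2 sf1.
have limE x : lim_ x = f x by rewrite /= opprB addrC subrK.
apply/cvg_ex; exists lim_; apply/cvgrPdist_le => e e0.
have e20 : 0 < e / 2 by rewrite divr_gt0.
have [psi Fpsi] := Fball _ e20.
apply: filterS (Fpsi) => phi h.
have : `|psi - lim_| <= e / 2.
  rewrite (l2_norm_le _ (ltW _))//.
  rewrite (eq_esum (b := fun x => (rnorm (psi x - f x) ^+ 2)%:E)) ?Fle// => x _.
  by rewrite -limE.
move=> h'; rewrite (splitr e) -(subrK psi lim_) -addrA.
apply: le_trans (ler_normD _ _) _; apply: lerD; last exact: ltW.
by rewrite distrC.
Qed.

HB.instance Definition _ := Uniform_isComplete.Build l2 l2_complete.
HB.instance Definition _ :=
  CompleteNormedModule_isHilbert.Build R l2 l2_dot_norm.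
End L2.

Section Frames.
Variables (R : realType) (K : hilbertType R) (I : choiceType).
Implicit Types (f : I -> K) (A B : R).

Definition frame_sum f (v : K) : \bar R :=
  \esum_(i in [set: I]) (rnorm (hdot v (f i)) ^+ 2)%:E.

Definition lower_frame_bound A f :=
  forall v : K, ((A * rnorm v ^+ 2)%:E <= frame_sum f v)%E.

Definition upper_frame_bound B f :=
  forall v : K, (frame_sum f v <= (B * rnorm v ^+ 2)%:E)%E.

Definition linear_span f : set K :=
  [set v | exists (s : seq I) (c : I -> R[i]), v = \sum_(i <- s) c i *: f i].

Definition frame f := exists A B,
  [/\ 0 < A, 0 < B, lower_frame_bound A f & upper_frame_bound B f].

Definition parseval_frame f := lower_frame_bound 1 f /\ upper_frame_bound 1 f.

Definition weak_frame f :=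
  (exists2 B, 0 < B & upper_frame_bound B f) /\ dense (linear_span f).

End Frames.

Definition separable (T : topologicalType) :=
  exists2 D : set T, countable D & dense D.

Section UnitaryRepresentations.
Variables (R : realType) (Gamma : groupType) (K : hilbertType R).

Definition unitary_operator (U : K -> K) :=
  [/\ linear U, forall v, exists u, U u = v &
      forall u v, hdot (U u) (U v) = hdot u v].

Record unitary_rep := UnitaryRep {
  rep_op :> Gamma -> K -> K;
  rep_unitary : forall g, unitary_operator (rep_op g);
  rep_opM : forall g h v, rep_op (g * h)%g v = rep_op g (rep_op h v)
}.

Definition parseval_frame_vector (sigma : unitary_rep) (phi : K) :=
  parseval_frame (fun g : Gamma => sigma g phi).

Definition frame_vector (sigma : unitary_rep) (phi : K) :=
  frame (fun g : Gamma => sigma g phi).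

Definition weak_frame_vector (sigma : unitary_rep) (phi : K) :=
  weak_frame (fun g : Gamma => sigma g phi).

Lemma unitary_rnorm (U : K -> K) v : unitary_operator U -> rnorm (U v) = rnorm v.
Proof.
case=> _ _ Udot; rewrite /rnorm; congr complex.Re; apply/eqP.
by rewrite -(@eqrXn2 _ 2)// -!hdot_norm Udot.
Qed.

Lemma rep_op1 (sigma : unitary_rep) v : sigma 1%g v = v.
Proof.
have [_ s1 _] := rep_unitary sigma 1%g; have [u <-] := s1 v.
by rewrite -rep_opM mulg1.
Qed.

End UnitaryRepresentations.

Section Cosets.
Variables (G : groupType) (S : pred G) (N : subGroupType S).

Definition right_coset (h : G) : set G := [set (val n * h)%g | n in [set: N]].

Record coset_space := CosetSpace {
  coset_set :> set G;
  coset_setP : `[< exists h, coset_set = right_coset h >]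
}.

HB.instance Definition _ := [isSub for coset_set].
HB.instance Definition _ := [Choice of coset_space by <:].

Definition coset_of (h : G) : coset_space :=
  CosetSpace (asboolT (ex_intro (fun k => right_coset h = right_coset k) h erefl)).

Lemma right_coset_mulr h g :
  [set (a * g)%g | a in right_coset h] = right_coset (h * g)%g.
Proof.
apply/seteqP; split=> [_ [_ [n _ <-] <-]|_ [n _ <-]].
  by exists n => //; rewrite mulgA.
by exists (val n * h)%g; [exists n|rewrite mulgA].
Qed.

Fact coset_act_subproof (x : coset_space) (g : G) :
  `[< exists h, [set (a * g)%g | a in x] = right_coset h >].
Proof.
have [h xh] := asboolW (coset_setP x); apply/asboolP; exists (h * g)%g.
by rewrite xh right_coset_mulr.
Qed.

Definition coset_act (x : coset_space) (g : G) : coset_space :=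
  CosetSpace (coset_act_subproof x g).

Lemma coset_act_of h g : coset_act (coset_of h) g = coset_of (h * g)%g.
Proof. by apply: val_inj; exact: right_coset_mulr. Qed.

Lemma coset_ofP (x : coset_space) : exists h, x = coset_of h.
Proof. by have [h xh] := asboolW (coset_setP x); exists h; apply: val_inj. Qed.

Lemma coset_act1 x : coset_act x 1%g = x.
Proof. by have [h ->] := coset_ofP x; rewrite coset_act_of mulg1. Qed.

Lemma coset_actM x g1 g2 :
  coset_act x (g1 * g2)%g = coset_act (coset_act x g1) g2.
Proof. by have [h ->] := coset_ofP x; rewrite !coset_act_of mulgA. Qed.

Lemma coset_act_bij g : set_bij [set: coset_space] [set: coset_space] (coset_act^~ g).
Proof.
split=> // [x y _ _ h|y _].
  by rewrite -(coset_act1 x) -(coset_act1 y) -(mulgV g) !coset_actM h.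
by exists (coset_act y g^-1%g) => //; rewrite -coset_actM mulVg coset_act1.
Qed.

(* N is a type with val : N -> G, so the values of a cocycle lie in N by typing. *)
Record cocycle := Cocycle {
  cocycle_fun :> coset_space -> G -> N;
  cocycleM : forall x g1 g2, cocycle_fun x (g1 * g2)%g =
    (cocycle_fun x g1 * cocycle_fun (coset_act x g1) g2)%g
}.

Lemma cocycle1 (alpha : cocycle) x : alpha x 1%g = 1%g.
Proof.
have := cocycleM alpha x 1%g 1%g; rewrite mulg1 coset_act1 => h.
by apply: (mulgI (alpha x 1%g)); rewrite -h mulg1.
Qed.

End Cosets.

Section Induced.
Variables (R : realType) (G : groupType) (S : pred G) (N : subGroupType S).
Variables (H : hilbertType R) (alpha : cocycle N) (pi : unitary_rep N H).
Local Notation L2H := (l2 (coset_space N) H).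

Fact induced_subproof (g : G) (phi : L2H) :
  (fun x => pi (alpha x g) (phi (coset_act x g))) \in @square_summable R _ H.
Proof.
rewrite unfold_in; apply/asboolP.
have := l2P phi; rewrite unfold_in => /asboolP; apply: le_lt_trans.
rewrite [leRHS](reindex_esum setT setT (fun x : coset_space N => coset_act x g))//; last exact: coset_act_bij.
apply: le_esum => x _; rewrite lee_fin.
by rewrite unitary_rnorm//; exact: rep_unitary.
Qed.

Definition induced_op (g : G) (phi : L2H) : L2H := L2 (induced_subproof g phi).

Lemma induced_opM g h phi :
  induced_op (g * h)%g phi = induced_op g (induced_op h phi).
Proof.
apply: val_inj; apply/funext => x /=.
by rewrite cocycleM coset_actM rep_opM.
Qed.

Lemma induced_op1 phi : induced_op 1%g phi = phi.
Proof.
by apply: val_inj; apply/funext => x /=; rewrite cocycle1 coset_act1 rep_op1.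
Qed.

Lemma induced_unitary g : unitary_operator (induced_op g).
Proof.
split=> [a phi psi|psi|phi psi].
- apply: val_inj; apply/funext => x /=.
  by have [+ _ _] := rep_unitary pi (alpha x g); apply.
- by exists (induced_op g^-1%g psi); rewrite -induced_opM mulgV induced_op1.
- rewrite -[RHS](csum_reindex (fun x => hdot (phi x) (psi x)) (coset_act_bij N g)).
  congr csum; apply/funext => x /=.
  by have [_ _ +] := rep_unitary pi (alpha x g); apply.
Qed.

Definition induced_rep : unitary_rep G L2H :=
  UnitaryRep induced_unitary induced_opM.

End Induced.

(* Main.v *)
From HB Require Import structures.
Require Import Defs.
From mathcomp Require Import all_boot all_order all_algebra complex finmap.
From mathcomp Require Import boolp classical_sets functions cardinality.
From mathcomp Require Import fsbigop reals ereal topology normedtype esum.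

Set Implicit Arguments.
Unset Strict Implicit.
Unset Printing Implicit Defensive.
Import Order.TTheory GRing.Theory Num.Theory.
Import numFieldNormedType.Exports.
Local Open Scope classical_set_scope.
Local Open Scope ring_scope.

(** The frame vector for the induced representation is the given vector phi
    placed at the identity coset and extended by 0, that is [delta o phi]
    with o the coset of 1.  Since [rho_g (delta o phi)] vanishes at every coset x with
    x g <> N, it lives at the single coset x = N g^-1, where its value is
    [pi (alpha x g) phi].  The whole theorem rests on the remark that
    g |-> (N g^-1, alpha (N g^-1) g) is a bijection from G onto G/N x N
    ([coset_coord_bij]): once x = N h is fixed, g runs through h^-1 N, and
    alpha(Nh, h^-1 n) = alpha(Nh, h^-1) alpha(N, n) runs once through N because
    n |-> alpha(N, n) does.  Hence the G-orbit of [delta o phi] is exactly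
    the family of all [delta x (pi_m phi)], one copy of the N-orbit of phi at
    each coset ([induced_orbitE]).

    The square moduli of the coefficients of v therefore add up to the sum over
    x of those of v(x) ([frame_sum_induced]), so any frame bound for the N-orbit,
    applied at each coset, gives the same bound for the G-orbit; as A and B are
    kept, the Parseval case A = B = 1 is included.  For the density of the span, a
    vector of l2 is approximated by its restriction to finitely many cosets
    ([l2_truncation]), whose values are approximated one by one by elements of
    the span of the N-orbit ([dense_span_induced]). *)

(** * Density and linear spans *)

Lemma dense_normP (R : realType) (K : hilbertType R) (D : set K) :
  dense D <->
  forall (v : K) (e : R[i]), 0 < e -> exists2 w, D w & `|v - w| < e.
Proof.
split=> [dD v e e0|aD O [v Ov] oO].
  have [||w []] := dD (ball v e).
  - by exists v; exact: ballxx.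
  - exact: ball_open.
  by rewrite -ball_normE => vw Dw; exists w.
have /nbhs_ballP[e /= e0 veO] : nbhs v O by exact: open_nbhs_nbhs.
have [w Dw vw] := aD v e e0; exists w; split=> //.
by apply: veO; rewrite -ball_normE.
Qed.

Section LinearSpan.
Variables (R : realType) (K : hilbertType R) (I : choiceType) (f : I -> K).

(** A family indexed by a list may repeat an index; counting multiplicities moves
    the combination to a common duplicate-free list, where two combinations can
    be added coefficientwise. *)
Lemma sum_count_mem (s r : seq I) (c : I -> R[i]) : {subset s <= r} -> uniq r ->
  \sum_(i <- s) c i *: f i = \sum_(i <- r) ((count_mem i s)%:R * c i) *: f i.
Proof.
move=> + ur; elim: s => [_|j s IHs sr].
  by rewrite big_nil big1// => i _; rewrite mul0r scale0r.
rewrite big_cons IHs; last by move=> i si; apply: sr; rewrite inE si orbT.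
rewrite [RHS](eq_bigr (fun i => (if i == j then c i *: f i else 0) +
  ((count_mem i s)%:R * c i) *: f i)); last first.
  move=> i _ /=; rewrite natrD mulrDl scalerDl eq_sym.
  by case: eqP => _; rewrite ?mul1r// mul0r scale0r.
rewrite big_split/=; congr (_ + _).
rewrite (bigD1_seq j) ?sr ?mem_head//= eqxx big1 ?addr0// => i.
by move=> /negPf ->.
Qed.

Lemma linear_spanD u v :
  linear_span f u -> linear_span f v -> linear_span f (u + v).
Proof.
move=> [s [c ->]] [t [d ->]]; exists (undup (s ++ t)).
exists (fun i => (count_mem i s)%:R * c i + (count_mem i t)%:R * d i).
rewrite (@sum_count_mem s (undup (s ++ t))) ?undup_uniq//; last first.
  by move=> i si; rewrite mem_undup mem_cat si.
rewrite (@sum_count_mem t (undup (s ++ t))) ?undup_uniq//; last first.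
  by move=> i si; rewrite mem_undup mem_cat si orbT.
by rewrite -big_split/=; apply: eq_bigr => i _; rewrite scalerDl.
Qed.

Lemma linear_span_sum (J : Type) (s : seq J) (u : J -> K) :
  (forall j, linear_span f (u j)) -> linear_span f (\sum_(j <- s) u j).
Proof.
move=> fu; elim/big_ind : _ => //; last exact: linear_spanD.
by exists [::], (fun=> 0); rewrite big_nil.
Qed.

Lemma linear_spanZ a i : linear_span f (a *: f i).
Proof. by exists [:: i], (fun=> a); rewrite big_seq1. Qed.

End LinearSpan.

(** * Vectors supported at one point *)

Lemma esum_single (R : realType) (X : choiceType) (x : X) (a : X -> \bar R) :
  (0 <= a x)%E -> (forall y, y != x -> a y = 0%E) ->
  \esum_(y in [set: X]) a y = a x.
Proof.
move=> ax0 a0; rewrite -(esum_set1 (t := x) (a := a))// [RHS]esum_mkcond.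
apply: eq_esum => y _; case: ifPn => //; rewrite notin_setE => /= /eqP.
exact: a0.
Qed.

Lemma rsum_single (R : realType) (X : choiceType) (x : X) (f : X -> R) :
  (forall y, y != x -> f y = 0) -> rsum f = f x.
Proof.
move=> f0; rewrite /rsum !(esum_single (x := x)) ?lee_fin ?le_max ?lexx ?orbT//=.
- by rewrite {3}(posnegE f).
- by move=> y /f0 ->; rewrite oppr0 maxxx.
- by move=> y /f0 ->; rewrite maxxx.
Qed.

Lemma csum_single (R : realType) (X : choiceType) (x : X) (f : X -> R[i]) :
  (forall y, y != x -> f y = 0) -> csum f = f x.
Proof.
move=> f0; rewrite /csum !(rsum_single (x := x)); first by case: (f x).
- by move=> y /f0 ->.
- by move=> y /f0 ->.
Qed.

Section Delta.
Variables (R : realType) (X : choiceType) (H : hilbertType R).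

Definition delta_fun (x : X) (h : H) : X -> H := fun y => if y == x then h else 0.

Fact delta_subproof x h : delta_fun x h \in @square_summable R X H.
Proof.
rewrite unfold_in; apply/asboolP; rewrite (esum_single (x := x)) ?ltry//.
  by rewrite lee_fin exprn_ge0 ?rnorm_ge0.
by move=> y yx; rewrite /delta_fun (negbTE yx) /rnorm normr0 expr0n.
Qed.

Definition delta x h : l2 X H := L2 (delta_subproof x h).

Lemma delta_linear x : linear (delta x).
Proof.
move=> a u v; apply: val_inj; apply/funext => y /=.
rewrite -[RHS]/(a *: delta_fun x u y + delta_fun x v y) /delta_fun.
by case: eqP => // _; rewrite scaler0 addr0.
Qed.

HB.instance Definition _ x :=
  GRing.isLinear.Build R[i] H (l2 X H) *:%R (delta x) (delta_linear x).

Lemma hdot_delta (v : l2 X H) x h : hdot v (delta x h) = hdot (v x) h.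
Proof.
rewrite -[LHS]/(csum _) (csum_single (x := x)) /= /delta_fun ?eqxx// => y /negPf yx.
by rewrite yx linear0r.
Qed.

Lemma norm_delta x h : `|delta x h| = `|h|.
Proof.
apply/eqP; rewrite -(@eqrXn2 _ 2)// -!hdot_norm hdot_delta /= /delta_fun.
by rewrite eqxx.
Qed.

Lemma l2_rnormE (v : l2 X H) :
  \esum_(x in [set: X]) (rnorm (v x) ^+ 2)%:E = (rnorm v ^+ 2)%:E.
Proof.
rewrite (esum_fin (f := fun x => rnorm (v x) ^+ 2)); last exact: l2_summable.
  congr _%:E; apply: complexI.
  by rewrite -l2_dotE rmorphXn /= rnormE -hdot_norm.
by move=> x; rewrite exprn_ge0 ?rnorm_ge0.
Qed.

Lemma l2_esumZ (c : R) (v : l2 X H) : 0 <= c ->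
  \esum_(x in [set: X]) (c * rnorm (v x) ^+ 2)%:E =
  (c * rnorm v ^+ 2)%:E.
Proof.
move=> c0; rewrite esumZ//; last exact: l2_summable.
  by rewrite l2_rnormE.
by move=> x; rewrite exprn_ge0 ?rnorm_ge0.
Qed.

Lemma l2_subE (u v : l2 X H) x : (u - v) x = u x - v x.
Proof. by []. Qed.

(** Pythagoras: removing one coordinate leaves a vector orthogonal to what was
    removed. *)
Lemma rnorm_sub_delta (v : l2 X H) x :
  rnorm (v - delta x (v x)) ^+ 2 = rnorm v ^+ 2 - rnorm (v x) ^+ 2.
Proof.
set d := delta x (v x).
have orth : hdot (v - d) d = 0.
  by rewrite /d hdot_delta l2_subE /= /delta_fun eqxx subrr linear0l.
apply/eqP; rewrite eq_sym subr_eq; apply/eqP/complexI.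
rewrite rmorphD !rmorphXn /= !rnormE -(norm_delta x (v x)) -!hdot_norm.
by rewrite -[in LHS](subrK d v) hnormDd.
Qed.

Lemma rnorm_sub_sum_delta (v : l2 X H) (s : seq X) : uniq s ->
  rnorm (v - \sum_(x <- s) delta x (v x)) ^+ 2 =
  rnorm v ^+ 2 - \sum_(x <- s) rnorm (v x) ^+ 2.
Proof.
elim: s v => [|x s IHs] v; first by rewrite !big_nil !subr0.
rewrite /= => /andP[xs us]; rewrite !big_cons.
(* Removing the coordinate at x does not affect those in s, as x is not in s. *)
pose w := v - delta x (v x).
have wE y : y \in s -> w y = v y.
  move=> ys; rewrite /w l2_subE /= /delta_fun; case: eqP => [yx|_]; last by rewrite subr0.
  by rewrite -yx ys in xs.
have sumE : \sum_(y <- s) delta y (v y) = \sum_(y <- s) delta y (w y).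
  by apply: eq_big_seq => y ys; rewrite wE.
have normE : \sum_(y <- s) rnorm (v y) ^+ 2 = \sum_(y <- s) rnorm (w y) ^+ 2.
  by apply: eq_big_seq => y ys; rewrite wE.
by rewrite opprD [in LHS]addrA -/w sumE IHs// /w rnorm_sub_delta normE opprD addrA.
Qed.

(** The squared norm is the supremum of its finite partial sums, and the squared
    error of a truncation is what the corresponding partial sum misses. *)
Lemma l2_truncation (v : l2 X H) (e : R[i]) : 0 < e ->
  exists s : seq X, `|v - \sum_(x <- s) delta x (v x)| < e.
Proof.
move=> e0.
have eE : e = real_complex R (complex.Re e) by rewrite RRe_real// gtr0_real.
have r0 : 0 < complex.Re e by rewrite -ltcR -eE.
have := @ub_ereal_sup_adherent R _ (complex.Re e ^+ 2) _ _.
move=> /(_ [set \sum_(x \in A) (rnorm (v x) ^+ 2)%:E | A in fsets [set: X]]%E).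
have -> : ereal_sup [set \sum_(x \in A) (rnorm (v x) ^+ 2)%:E |
    A in fsets [set: X]]%E = (rnorm v ^+ 2)%:E by exact: l2_rnormE.
case=> [||_ [A [finA _] <-]]; rewrite ?exprn_gt0//.
rewrite fsbig_finite// sumEFin -EFinB lte_fin => vA.
exists (fset_set A : {fset X}).
rewrite eE -rnormE ltcR -ltr_sqr ?nnegrE ?rnorm_ge0 ?(ltW r0)//.
by rewrite rnorm_sub_sum_delta ?fset_uniq// ltrBlDr -ltrBlDl.
Qed.

End Delta.

(** * Group elements as pairs of a coset and an element of the subgroup *)

Section CosetCoordinates.
Variables (G : groupType) (S : pred G) (N : subGroupType S).

Lemma coset_of_eq h k :
  coset_of N h = coset_of N k -> exists n : N, (h = val n * k)%g.
Proof.
move=> /(congr1 (@coset_set _ _ _)) /= hk.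
have : right_coset N h h by exists 1%g => //; rewrite gmulf1 mul1g.
by rewrite hk => -[n _ <-]; exists n.
Qed.

Lemma coset_of_mull (n : N) h : coset_of N (val n * h)%g = coset_of N h.
Proof.
apply: val_inj; apply/seteqP; split=> [_ [m _ <-]|_ [m _ <-]].
  by exists (m * n)%g => //; rewrite gmulfM mulgA.
by exists (m * n^-1)%g => //; rewrite gmulfM gmulfV -mulgA mulKg.
Qed.

Variable alpha : cocycle N.

Definition coset_coord (g : G) : coset_space N * N :=
  (coset_of N g^-1%g, alpha (coset_of N g^-1%g) g).

(** Elements g and g' in the same left coset of N differ by some n in N on the
    right, which multiplies the cocycle by alpha(N, n): injectivity and
    surjectivity on each fibre are those of n |-> alpha(N, n). *)
Lemma coset_coord_bij :
  bijective (fun n : N => alpha (coset_of N 1%g) (val n)) ->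
  set_bij [set: G] [set: coset_space N * N] coset_coord.
Proof.
move=> [beta alphaK betaK].
split=> // [g g' _ _ /pair_equal_spec[/esym/coset_of_eq[n gg']]|[x m] _].
  have {gg'} -> : g' = (g * val (n^-1))%g.
    by apply: invg_inj; rewrite gg' gmulfV invgM !invgK.
  rewrite invgM gmulfV invgK coset_of_mull cocycleM coset_act_of mulVg.
  rewrite -{1}[alpha _ g]mulg1 -gmulfV => /mulgI n1.
  have -> : (n^-1)%g = 1%g.
    by apply: (can_inj alphaK); rewrite -n1 gmulf1 cocycle1.
  by rewrite gmulf1 mulg1.
have [h ->] := coset_ofP x.
(* By the cocycle identity, n must solve alpha(Nh, h^-1) alpha(N, n) = m. *)
exists (h^-1 * val (beta ((alpha (coset_of N h) h^-1)^-1 * m)))%g => //.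
rewrite /coset_coord invgM invgK -gmulfV coset_of_mull; congr pair.
by rewrite cocycleM coset_act_of mulgV betaK mulgA mulgV mul1g.
Qed.

End CosetCoordinates.

(** * Frame bounds and density for the induced representation *)

Lemma unitary0 (R : realType) (K : hilbertType R) (U : K -> K) :
  unitary_operator U -> U 0 = 0.
Proof.
by case=> /(_ (-1) 0 0) + _ _; rewrite scaler0 add0r scaleN1r addNr.
Qed.

Section InducedFrame.
Variables (R : realType) (G : groupType) (S : pred G) (N : subGroupType S).
Variables (H : hilbertType R) (alpha : cocycle N) (pi : unitary_rep N H).
Hypothesis alpha_bij : bijective (fun n : N => alpha (coset_of N 1%g) (val n)).
Variable phi : H.

Let orbit (n : N) : H := pi n phi.
Let induced_orbit (g : G) : l2 (coset_space N) H :=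
  induced_rep alpha pi g (delta (coset_of N 1%g) phi).

(** The vector [delta (coset_of N 1) phi] evaluated at x g is nonzero only for
    x = N g^-1. *)
Lemma induced_orbitE g : induced_orbit g =
  delta (coset_coord alpha g).1 (orbit (coset_coord alpha g).2).
Proof.
apply: val_inj; apply/funext => x /=; rewrite /delta_fun /=.
have [->|xg] := eqVneq x (coset_of N g^-1%g).
  by rewrite coset_act_of mulVg eqxx.
case: eqP => [xo|_]; last exact/unitary0/rep_unitary.
move/eqP: xg; case.
by rewrite -(coset_act1 x) -(mulgV g) coset_actM xo coset_act_of mul1g.
Qed.

(** Summing over G becomes a double sum over G/N and N along [coset_coord_bij]. *)
Lemma frame_sum_induced v :
  frame_sum induced_orbit v =
  \esum_(x in [set: coset_space N]) frame_sum orbit (v x).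
Proof.
rewrite /frame_sum esum_esum; last first.
  by move=> *; rewrite lee_fin exprn_ge0 ?rnorm_ge0.
have -> : [set: coset_space N] `*`` (fun=> [set: N]) = [set: coset_space N * N].
  by apply/seteqP; split.
rewrite [RHS](reindex_esum _ _ _ _ (coset_coord_bij alpha_bij)).
apply: eq_esum => g _.
by rewrite induced_orbitE hdot_delta.
Qed.

Lemma lower_frame_bound_induced A : 0 <= A ->
  lower_frame_bound A orbit -> lower_frame_bound A induced_orbit.
Proof.
move=> A0 lo v; rewrite frame_sum_induced -l2_esumZ//.
by apply: le_esum => x _; exact: lo.
Qed.

Lemma upper_frame_bound_induced B : 0 <= B ->
  upper_frame_bound B orbit -> upper_frame_bound B induced_orbit.
Proof.
move=> B0 up v; rewrite frame_sum_induced -l2_esumZ//.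
by apply: le_esum => x _; exact: up.
Qed.

(** For fixed x every m in N is the second coordinate of some g in G, so all of
    [delta x (pi_m phi)] occur in the G-orbit. *)
Lemma linear_span_delta x h :
  linear_span orbit h -> linear_span induced_orbit (delta x h).
Proof.
move=> [s [c ->]]; rewrite linear_sum; apply: linear_span_sum => n.
have [_ _ /(_ (x, n) I)[g _ gx]] := coset_coord_bij alpha_bij.
rewrite linearZ/= -[delta x _]/(delta (x, n).1 (orbit (x, n).2)) -gx.
by rewrite -induced_orbitE; exact: linear_spanZ.
Qed.

Lemma dense_span_induced :
  dense (linear_span orbit) -> dense (linear_span induced_orbit).
Proof.
move=> /dense_normP dorb; apply/dense_normP => v e e0.
have e2 : 0 < e / 2 by rewrite divr_gt0.
have [s vs] := l2_truncation v e2.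
suff [w Ow ws] : exists2 w, linear_span induced_orbit w &
    `|\sum_(x <- s) delta x (v x) - w| < e / 2.
  exists w => //; rewrite (splitr e).
  rewrite -(subrK (\sum_(x <- s) delta x (v x)) v) -addrA.
  exact: le_lt_trans (ler_normD _ _) (ltrD vs ws).
(* Each coset in s takes half of the error that remains. *)
elim: s (e / 2) e2 {vs} => [|x s IHs] d d0.
  exists 0; last by rewrite big_nil subr0 normr0.
  by exists [::], (fun=> 0); rewrite big_nil.
have d2 : 0 < d / 2 by rewrite divr_gt0.
have [h oh vh] := dorb (v x) _ d2; have [w Ow ws] := IHs _ d2.
exists (delta x h + w); first by apply: linear_spanD => //; exact: linear_span_delta.
rewrite big_cons opprD addrACA -linearB (splitr d).
by apply: le_lt_trans (ler_normD _ _) _; rewrite norm_delta ltrD.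
Qed.

End InducedFrame.

Theorem theorem3p17 (R : realType) (G : groupType) (S : pred G)
    (N : subGroupType S) (H : hilbertType R) (alpha : cocycle N)
    (pi : unitary_rep N H) :
  ([set: G] #= [set: nat])%card -> ([set: N] #= [set: nat])%card ->
  separable H ->
  bijective (fun n : N => alpha (coset_of N 1%g) (val n)) ->
  [/\ (exists phi, parseval_frame_vector pi phi) ->
        exists Phi, parseval_frame_vector (induced_rep alpha pi) Phi,
      (exists phi, frame_vector pi phi) ->
        exists Phi, frame_vector (induced_rep alpha pi) Phi &
      (exists phi, weak_frame_vector pi phi) ->
        exists Phi, weak_frame_vector (induced_rep alpha pi) Phi].
Proof.
move=> _ _ _ abij; split=> -[phi]; rewrite /parseval_frame_vector /frame_vector
  /weak_frame_vector => fphi; exists (delta (coset_of N 1%g) phi).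
- case: fphi => lo up; split; first exact: lower_frame_bound_induced.
  exact: upper_frame_bound_induced.
- have [A [B [A0 B0 lo up]]] := fphi; exists A, B; split=> //.
    exact/lower_frame_bound_induced/lo/ltW.
  exact/upper_frame_bound_induced/up/ltW.
- have [[B B0 up] dphi] := fphi; split; last exact: dense_span_induced.
  by exists B => //; exact/upper_frame_bound_induced/up/ltW.
Qed.
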